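(* For $\mathcal R(X)$ corresponding to the Neyman $\chi^2$-divergence, obtaining an $\epsilon$-accurate estimation of $\mathcal R(X)$ can require an arbitrarily large number of samples.
   Context: Here $P$ is a probability measure on a measurable space $(\Omega,\mathcal F)$, $X:\Omega\to[-B,B]$ (with $B\ge0$) is measurable, $\tau\ge0$ is a radius, and $$\mathcal R(X)=\sup\Big\{\int_\Omega X\zeta\,dP:\ \zeta\ge 0 \text{ measurable},\ \int_\Omega\zeta\,dP=1,\ \int_\Omega\phi(\zeta)\,dP\le\tau\Big\},$$ where $\phi$ is the divergence function. The Neyman $\chi^2$-divergence corresponds to $\phi(x)=(x-1)^2/x$ for $x>0$ and $\phi(x)=+\infty$ for $x\le0$. The estimation of $\mathcal R(X)$ is based on samples drawn independently from $P$, and an estimate is $\epsilon$-accurate if it differs from $\mathcal R(X)$ by at most $\epsilon$. *)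

(* Defs.v *)
From HB Require Import structures.
From mathcomp Require Import all_boot all_order all_algebra.
From mathcomp Require Import all_classical all_reals all_analysis.

Set Implicit Arguments.
Unset Strict Implicit.
Unset Printing Implicit Defensive.

Import Order.TTheory GRing.Theory Num.Theory.
Import numFieldNormedType.Exports.

Local Open Scope classical_set_scope.
Local Open Scope ring_scope.

(* A divergence function is [phi : R -> \bar R], so that the value +oo is
   allowed, as for the Neyman divergence. *)
Definition neyman_phi (R : realType) (x : R) : \bar R :=
  if 0 < x then ((x - 1) ^+ 2 / x)%:E else +oo%E.

Section phi_risk.
Local Open Scope ereal_scope.
Context d (Omega : measurableType d) (R : realType).
Implicit Types (phi : R -> \bar R) (P : probability Omega R) (X : Omega -> R).

Definition phi_ball phi P (tau : R) : set (Omega -> R) :=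
  [set zeta : Omega -> R | [/\ measurable_fun [set: Omega] zeta,
                  forall w, (0 <= zeta w)%R,
                  \int[P]_w (zeta w)%:E = 1 &
                  \int[P]_w phi (zeta w) <= tau%:E]].

Definition phi_risk phi P (tau : R) X : \bar R :=
  ereal_sup [set \int[P]_w (X w * zeta w)%:E | zeta in phi_ball phi P tau].

End phi_risk.

Section iid_samples.
Context d (Omega : measurableType d) (R : realType).

Definition tuple_cons n (x : Omega * n.-tuple Omega) : n.+1.-tuple Omega :=
  [tuple of x.1 :: x.2].

Lemma measurable_tuple_cons n : measurable_fun [set: _] (@tuple_cons n).
Proof. exact: measurable_cons measurable_fst measurable_snd. Qed.

HB.instance Definition _ n :=
  isMeasurableFun.Build _ _ _ _ (@tuple_cons n) (@measurable_tuple_cons n).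

(* The n-fold product of P, on the product sigma-algebra of n.-tuple Omega:
   the joint law of n independent samples from P. *)
Fixpoint iid_law (P : probability Omega R) n : probability (n.-tuple Omega) R :=
  match n with
  | 0 => \d_([tuple] : 0.-tuple Omega)
  | m.+1 => distribution (P \x iid_law P m)%E (@tuple_cons m)
  end.

Lemma iid_law_rect (P : probability Omega R) n (A : 'I_n -> set Omega) :
  (forall i, measurable (A i)) ->
  iid_law P n [set s | forall i, A i (tnth s i)] = (\prod_(i < n) P (A i))%E.
Proof.
elim: n A => [|n IH] A mA.
  by rewrite big_ord0 /= diracE mem_set//= => -[].
rewrite big_ord_recl -IH//= /distribution /pushforward.
have mB : measurable [set s : n.-tuple Omega |
    forall i, A (lift ord0 i) (tnth s i)].
  rewrite (_ : [set _ | _] = \bigcap_(i in [set: 'I_n])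
      ((fun s : n.-tuple Omega => tnth s i) @^-1` A (lift ord0 i))); last first.
    by apply/seteqP; split => s /= h i; [move=> _|]; exact: h.
  apply: fin_bigcap_measurable => [|i _]; first exact: finite_finset.
  by rewrite -[X in measurable X]setTI; exact: measurable_tnth.
rewrite -product_measure1E//; congr (_ _).
apply/seteqP; split => -[x s] /=.
  move=> h; split; first by have := h ord0; rewrite tnth0.
  by move=> i; have := h (lift ord0 i); rewrite tnthS.
move=> [h0 h] i; case: (unliftP ord0 i) => [j|] ->; first by rewrite tnthS.
by rewrite tnth0.
Qed.

End iid_samples.

(* [T], a function of n sampled points, estimates the risk of [X] within [eps],
   with probability at least [1 - delta], whatever the sampled law [P]: the
   estimator may depend on X, tau, eps, delta and n, but not on P. *)
Definition accurate_estimator (R : realType) d (Omega : measurableType d)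
    (phi : R -> \bar R) (tau : R) (X : Omega -> R) (eps delta : R) n
    (T : n.-tuple Omega -> R) : Prop :=
  measurable_fun [set: n.-tuple Omega] T /\
  forall P : probability Omega R,
    ((1 - delta)%:E <=
     iid_law P n [set s | `|(T s)%:E - phi_risk phi P tau X| <= eps%:E])%E.

(* Main.v *)
(* Under the Neyman divergence a point of vanishing P-mass may still receive a
   mass bounded away from 0 under the reweighted law. Take P = Bernoulli(q) on
   {true, false} and X = B on true, 0 on false. For q = 0 the risk is 0. For
   small q > 0, moving the mass s = tau / (1 + tau) onto true costs
   (1 - q)^2 / (1 - s) + q^2 / s - 1 <= tau, so the risk is at least B s. Yet
   the all-false sample has probability (1 - q)^n, as close to 1 as desired, so
   an estimator's value there would have to be accurate for both laws. *)
Require Import Defs.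
From mathcomp Require Import all_boot all_order all_algebra.
From mathcomp Require Import all_classical all_reals all_analysis.
From mathcomp Require Import measurable_realfun.
From mathcomp Require Import ring lra.

Set Implicit Arguments.
Unset Strict Implicit.
Unset Printing Implicit Defensive.

Import Order.TTheory GRing.Theory Num.Theory.
Import numFieldNormedType.Exports.

Local Open Scope classical_set_scope.
Local Open Scope ring_scope.

Lemma bernoulli_ineq (R : realDomainType) (q : R) n :
  0 <= q <= 1 -> 1 - n%:R * q <= (1 - q) ^+ n.
Proof.
move=> /andP[q0 q1]; elim: n => [|n IH]; first by rewrite mul0r subr0 expr0.
rewrite exprS -natr1.
have := ler_wpM2l (_ : 0 <= 1 - q) IH; rewrite subr_ge0 => /(_ q1).
apply: le_trans; rewrite -subr_ge0.
rewrite (_ : _ - _ = n%:R * q ^+ 2); first by rewrite mulr_ge0// exprn_ge0.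
ring.
Qed.

Lemma neyman_phi_ge0 (R : realType) (x : R) : (0 <= neyman_phi x)%E.
Proof.
rewrite /neyman_phi; case: ifPn => // x0.
by rewrite lee_fin divr_ge0 ?sqr_ge0// ltW.
Qed.

Section likely_sample.
Context d (Omega : measurableType d) (R : realType).
Variables (phi : R -> \bar R) (tau eps delta : R) (X : Omega -> R) (n : nat).
Variable T : n.-tuple Omega -> R.

Lemma measurable_accurate (r : \bar R) : measurable_fun [set: _] T ->
  measurable [set s | `|(T s)%:E - r| <= eps%:E]%E.
Proof.
move=> mT; rewrite -[X in measurable X]setTI; apply: measurable_lee => //.
apply: measurableT_comp => //.
apply: emeasurable_funB => //.
exact/measurable_EFinP.
Qed.

(** An event of probability at least [1 - delta] cannot miss an outcome of probability more than
    [delta], here the constant sample at [x]. This turns accuracy in probability into a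
    deterministic constraint on a single value of [T]. *)
Lemma accurate_at_nseq (P : probability Omega R) (x : Omega) :
  accurate_estimator phi tau X eps delta T -> measurable [set x] ->
  (delta%:E < \prod_(i < n) P [set x])%E ->
  (`|(T [tuple of nseq n x])%:E - phi_risk phi P tau X| <= eps%:E)%E.
Proof.
move=> [mT /(_ P) acc] mx dP; apply: contrapT => nacc.
have mA : measurable [set s : n.-tuple Omega | forall i, [set x] (tnth s i)].
  rewrite (_ : [set _ | _] = \bigcap_(i in [set: 'I_n])
      ((fun s : n.-tuple Omega => tnth s i) @^-1` [set x])); last first.
    by apply/seteqP; split => s /= h i; [move=> _|]; exact: h.
  apply: fin_bigcap_measurable => [|i _]; first exact: finite_finset.
  by rewrite -[X in measurable X]setTI; exact: measurable_tnth.
have sub : [set s | `|(T s)%:E - phi_risk phi P tau X| <= eps%:E]%E `<=`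
    ~` [set s : n.-tuple Omega | forall i, [set x] (tnth s i)].
  move=> s /= Ts sx; apply: nacc; suff <- : s = [tuple of nseq n x] by [].
  by apply: eq_from_tnth => i; rewrite sx tnth_nseq.
have accC : (iid_law P n [set s | `|(T s)%:E - phi_risk phi P tau X| <= eps%:E]
    <= 1 - \prod_(i < n) P [set x])%E.
  rewrite -(iid_law_rect P (A := fun=> [set x]))// -probability_setC//.
  by apply: le_measure sub; rewrite inE;
    [exact: measurable_accurate|exact: measurableC].
have := le_trans acc accC; move: dP; case: (\prod_(_ < _) _)%E => [p| |]//.
by rewrite lte_fin -EFinB lee_fin; lra.
Qed.

End likely_sample.

Section bernoulli_risk.
Context (R : realType).
Variables (B tau : R).
Hypotheses (hB : 0 < B) (htau : 0 < tau).
Let X (w : bool) : R := if w then B else 0.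
Let s := tau / (1 + tau).

(** All the mass sits on [false], where [X] vanishes, so every reweighting integrates to 0. *)
Lemma phi_risk_bernoulli0 :
  (phi_risk (@neyman_phi R) (bernoulli_prob 0) tau X <= 0)%E.
Proof.
apply: ge_ereal_sup => _ [zeta [_ zeta0 _ _] <-].
rewrite integral_bernoulli_prob ?lexx ?ler01//.
  by rewrite mul0e add0e /X mul0r mule0.
by move=> w; rewrite lee_fin mulr_ge0 // /X; case: ifP => // _; exact: ltW.
Qed.

Lemma phi_risk_bernoulli_ge (q : R) : 0 < q <= s ->
  ((B * s)%:E <= phi_risk (@neyman_phi R) (bernoulli_prob q) tau X)%E.
Proof.
move=> /andP[q0 qs].
have t1 : 0 < 1 + tau by rewrite addr_gt0.
have s0 : 0 < s by rewrite divr_gt0.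
have s1E : 1 - s = (1 + tau)^-1 by rewrite /s; field; rewrite gt_eqF.
have s1 : 0 < 1 - s by rewrite s1E invr_gt0.
have q1 : 0 < 1 - q by lra.
have q01 : 0 <= q <= 1 by apply/andP; split; lra.
(* The density of Bernoulli([s]) with respect to Bernoulli([q]); under it [X] has mean [B * s]. *)
pose zeta (w : bool) := if w then s / q else (1 - s) / (1 - q).
have zeta0 w : 0 < zeta w by rewrite /zeta; case: ifP => _; exact: divr_gt0.
apply: le_ereal_sup_tmp; exists (\int[bernoulli_prob q]_w (X w * zeta w)%:E)%E.
  exists zeta => //; split.
  - by [].
  - by move=> w; exact: ltW.
  - rewrite integral_bernoulli_prob//; last by move=> w; rewrite lee_fin ltW.
    rewrite -!EFinM -EFinD /zeta /unstable.onem; congr EFin.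
    by field; rewrite !gt_eqF.
  - rewrite integral_bernoulli_prob//; last by move=> w; exact: neyman_phi_ge0.
    rewrite /neyman_phi !zeta0 -!EFinM -EFinD lee_fin /zeta /unstable.onem.
    (* Since [1 / (1 - s) = 1 + tau], the divergence tends to exactly [tau] as [q] tends to 0. For
       positive [q] the subtracted term is nonnegative because [q <= s]. *)
    rewrite [leLHS](_ : _ = tau - q * (2 * s - q) * (1 + tau) / s); last first.
      by rewrite /s; field; rewrite addrK oner_eq0 !gt_eqF.
    rewrite lerBlDr lerDl divr_ge0 ?(ltW s0)// !mulr_ge0//; lra.
rewrite integral_bernoulli_prob//; last first.
  move=> w; rewrite lee_fin mulr_ge0//; last exact: ltW.
  by rewrite /X; case: ifP => // _; exact: ltW.
rewrite -!EFinM -EFinD lee_fin /X /zeta mul0r mulr0 addr0.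
by rewrite [leRHS]mulrCA (mulrCA q) divff ?gt_eqF// mulr1.
Qed.

End bernoulli_risk.

Theorem corollary4p3 (R : realType) (B tau : R) (hB : 0 < B) (htau : 0 < tau) :
  exists (d : measure_display) (Omega : measurableType d) (X : Omega -> R),
    [/\ measurable_fun [set: Omega] X,
        forall w : Omega, - B <= X w <= B &
        exists2 eps0 : R, 0 < eps0 &
          forall eps : R, 0 < eps < eps0 ->
          forall delta : R, 0 < delta < 1 ->
          forall n : nat,
            ~ exists T : n.-tuple Omega -> R,
                accurate_estimator (@neyman_phi R) tau X eps delta T].
Proof.
pose s := tau / (1 + tau).
pose X (w : bool) : R := if w then B else 0.
have s0 : 0 < s by rewrite divr_gt0// addr_gt0.
have s1 : s < 1 by rewrite ltr_pdivrMr ?addr_gt0// mul1r ltrDr.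
exists _, bool, X; split.
- by [].
- by move=> w; rewrite /X; case: ifP => _; apply/andP; split; lra.
(* Half the gap between the two risks: no number lies within [eps < B * s / 2] of both. *)
exists (B * s / 2); first by rewrite divr_gt0// mulr_gt0.
move=> eps /andP[eps0 epsB] delta /andP[d0 d1] n [T acc].
(* The bound [s] keeps [bernoulli_prob q] in the range of the risk estimate; the other makes the
   all-false sample likely. Dividing by [n.+1] rather than [n] makes [n%:R * q < 1 - delta] strict
   and keeps [q] positive when [n = 0]. *)
pose q := Num.min s ((1 - delta) / n.+1%:R).
have q0 : 0 < q by rewrite lt_min s0 divr_gt0// subr_gt0.
have qs : q <= s by rewrite ge_min lexx.
have nq : n%:R * q < 1 - delta.
  have : n.+1%:R * q <= 1 - delta.
    by rewrite mulrC -ler_pdivlMr// ge_min lexx orbT.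
  by rewrite -natr1; lra.
(* To be applied at [p = 0] and [p = q]: the same value of [T] must serve both laws. The all-false
   sample has mass [(1 - p) ^+ n >= 1 - n%:R * p > delta]. *)
have acc_false p : 0 <= p <= 1 -> n%:R * p < 1 - delta ->
  (`|(T [tuple of nseq n false])%:E -
     phi_risk (@neyman_phi R) (bernoulli_prob p) tau X| <= eps%:E)%E.
  move=> p01 np; apply: accurate_at_nseq acc _ _ => //.
  have Pf : bernoulli_prob p [set false] = (1 - p)%:E.
    by rewrite bernoulli_probE// !diracE memNset// mem_set// mule0 add0e mule1.
  rewrite (eq_bigr (fun=> (1 - p)%:E))// prodEFin lte_fin prodr_const card_ord.
  by apply: lt_le_trans (bernoulli_ineq n p01); lra.
set t := T _ in acc_false.
have := acc_false 0; rewrite lexx ler01 mulr0 subr_gt0 => /(_ isT d1).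
have := acc_false q; rewrite (ltW q0) (le_trans qs (ltW s1)) => /(_ isT nq).
have := @phi_risk_bernoulli_ge _ _ _ hB htau q; rewrite q0 qs => /(_ isT).
have := @phi_risk_bernoulli0 _ _ tau hB.
(* An infinite risk would be infinitely far from the real [t], so only real risks remain. *)
case: (phi_risk _ _ _ _) => [r0| |] //; case: (phi_risk _ _ _ _) => [r1| |] //.
rewrite !lee_fin !ler_norml -/s => r0_le r1_ge /andP[r1l r1u] /andP[r0l r0u].
lra.
Qed.
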